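(* Let $M$ be an $EMV$-algebra. The mapping $\theta:\mathcal{SM}(M)\to\mathrm{MaxI}(M)$ defined by $s\mapsto\mathrm{Ker}(s)$ is a homeomorphism (where $\mathcal{SM}(M)$ carries the weak topology of state-morphisms and $\mathrm{MaxI}(M)$ the hull-kernel topology). In addition, the following statements are equivalent: (i) $M$ has a top element. (ii) $\mathcal{SM}(M)$ is compact in the weak topology of state-morphisms. (iii) $\mathrm{MaxI}(M)$ is compact in the hull-kernel topology.
   Context: An $EMV$-algebra is an algebra $(M;\vee,\wedge,\oplus,0)$ of type $(2,2,2,0)$ such that: (i) $(M;\oplus,0)$ is a commutative monoid with neutral element $0$; (ii) $(M;\vee,\wedge,0)$ is a distributive lattice with bottom element $0$; (iii) for each idempotent $a$ of $M$ (an element with $a\oplus a=a$; $\mathcal I(M)$ denotes the set of idempotents), $([0,a];\oplus,\lambda_a,0,a)$ is an $MV$-algebra, where $[0,a]=\{x\in M\mid x\le a\}$ and $\lambda_a(x)=\min\{z\in[0,a]\mid z\oplus x=a\}$; (iv) for each $x\in M$ there is $a\in\mathcal I(M)$ with $x\le a$. A top element is not assumed. An $EMV$-homomorphism is a map $f$ between $EMV$-algebras preserving $\vee,\wedge,\oplus,0$ with $f(\lambda_b(x))=\lambda_{f(b)}(f(x))$ for each idempotent $b$ and $x\in[0,b]$. A state-morphism on $M$ is an $EMV$-homomorphism $s:M\to[0,1]$ (with $[0,1]$ the standard $MV$-algebra, $x\oplus y=\min\{x+y,1\}$) such that $s(x)=1$ for some $x\in M$. $\mathcal{SM}(M)$ is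 the set of state-morphisms on $M$; its weak topology is the subspace topology inherited from the product topology on $[0,1]^M$. $\mathrm{Ker}(s)=\{x\in M\mid s(x)=0\}$. An ideal of $M$ is a non-empty subset $I$ that is downward closed and closed under $\oplus$; it is maximal if it is proper and not properly contained in another proper ideal. $\mathrm{MaxI}(M)$ is the set of maximal ideals of $M$; the open sets of its hull-kernel topology are the sets $O(I)=\{A\in\mathrm{MaxI}(M)\mid A\not\supseteq I\}$, $I$ an ideal of $M$.
   Formalization: The monoid (M;⊕,0) is additionally required to be ordered (x≤y implies x⊕z≤y⊕z), i.e. the lattice order on each [0,a] is the natural MV-order; without this the axioms as listed admit an M with SM(M) empty but MaxI(M) non-empty. *)

(* Defs.v *)
From HB Require Import structures.
From mathcomp Require Import all_boot all_order all_algebra.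
From mathcomp Require Import all_classical all_reals all_analysis.
From mathcomp Require Import lra.

Set Implicit Arguments.
Unset Strict Implicit.
Unset Printing Implicit Defensive.

Import Order.TTheory GRing.Theory Num.Theory.
Import numFieldNormedType.Exports.

Local Open Scope classical_set_scope.
Local Open Scope order_scope.

(** ** MV-algebras and EMV-algebras *)

(* The subset [A] of [T], with the restrictions of the given operations, is an
   MV-algebra. *)
Record MV_algebra_on (T : Type) (A : set T) (op : T -> T -> T) (neg : T -> T)
    (zero one : T) : Prop := MVAlgebraOn {
  MV_zero : A zero;
  MV_one : A one;
  MV_op : forall x y, A x -> A y -> A (op x y);
  MV_neg : forall x, A x -> A (neg x);
  MV_opA : forall x y z, A x -> A y -> A z -> op x (op y z) = op (op x y) z;
  MV_opC : forall x y, A x -> A y -> op x y = op y x;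
  MV_op0 : forall x, A x -> op x zero = x;
  MV_negK : forall x, A x -> neg (neg x) = x;
  MV_neg0 : neg zero = one;
  MV_op1 : forall x, A x -> op x one = one;
  MV_luk : forall x y, A x -> A y ->
    op (neg (op (neg x) y)) y = op (neg (op (neg y) x)) x
}.

Definition is_min d (T : porderType d) (A : set T) (z : T) : Prop :=
  A z /\ lbound A z.

(* The z in [0, a] such that z (+) x = a. *)
Definition complements d (T : porderType d) (op : T -> T -> T) (a x : T) :
  set T := [set z | z <= a /\ op z x = a].

(* lambda_a(x); the default value \bot is only reached when the minimum does
   not exist, which [lambda_min] below rules out for a idempotent, x <= a. *)
Definition lambda_of d (T : bPOrderType d) (op : T -> T -> T) (a x : T) : T :=
  xget \bot [set z | is_min (complements op a x) z].

(* The order on M is required to be compatible with the monoid operation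
   ([le_oplus]): M is a commutative ordered monoid. Equivalently, the order of
   the lattice M restricts to the natural order of the MV-algebra [0, a] for
   every idempotent a. Without it the order of M may be any distributive lattice
   order that merely extends the natural orders, and a maximal ideal need not be
   the kernel of a state-morphism. *)
HB.mixin Record isEMV d (M : Type) of Order.BDistrLattice d M := {
  oplus : M -> M -> M;
  oplusA : associative oplus;
  oplusC : commutative oplus;
  oplus0x : left_id (\bot : M) oplus;
  le_oplus : forall z x y : M, x <= y -> oplus x z <= oplus y z;
  lambda_min : forall a x : M, oplus a a = a -> x <= a ->
    exists z, is_min (complements oplus a x) z;
  emv_MV : forall a : M, oplus a a = a ->
    MV_algebra_on [set x | x <= a] oplus (lambda_of oplus a) \bot a;
  idem_above : forall x : M, exists2 a, oplus a a = a & x <= a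
}.

#[short(type="emvType")]
HB.structure Definition EMV d := {M of isEMV d M & Order.BDistrLattice d M}.

Declare Scope emv_scope.
Delimit Scope emv_scope with EMV.
Local Open Scope emv_scope.
Notation "x ⊕ y" := (oplus x y) (at level 50, left associativity) : emv_scope.

Definition idem d (M : emvType d) (a : M) : Prop := a ⊕ a = a.

Definition lambda d (M : emvType d) (a x : M) : M := lambda_of oplus a x.

Definition has_top d (M : emvType d) : Prop := exists t : M, forall x, x <= t.

Record emv_hom d d' (M : emvType d) (N : emvType d') (f : M -> N) : Prop :=
  EMVHom {
  emv_homU : forall x y, f (x `|` y) = f x `|` f y;
  emv_homI : forall x y, f (x `&` y) = f x `&` f y;
  emv_homD : forall x y, f (x ⊕ y) = f x ⊕ f y;
  emv_hom0 : f \bot = \bot;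
  emv_hom_lambda : forall b x, idem b -> x <= b ->
    f (lambda b x) = lambda (f b) (f x)
}.

(** ** Ideals *)

Definition ideal d (M : emvType d) (I : set M) : Prop :=
  [/\ I !=set0,
      forall x y, x <= y -> I y -> I x
    & forall x y, I x -> I y -> I (x ⊕ y)].

Definition maximal_ideal d (M : emvType d) (I : set M) : Prop :=
  [/\ ideal I, I <> setT
    & forall J, ideal J -> J <> setT -> ~ (I `<` J)].

Section emv_theory.
Context d (M : emvType d).
Implicit Types (x y z u v w a b : M) (I J : set M).

Lemma oplusx0 x : x ⊕ \bot = x.
Proof. by rewrite oplusC oplus0x. Qed.

Lemma leD x y u v : x <= y -> u <= v -> x ⊕ u <= y ⊕ v.
Proof.
move=> xy uv; apply: (le_trans (le_oplus u _ _ xy)).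
by rewrite ![y ⊕ _]oplusC; exact: le_oplus.
Qed.

Lemma leDl x y : x <= x ⊕ y.
Proof. by rewrite -[leLHS]oplusx0; apply: leD (le0x _). Qed.

Lemma leDr x y : x <= y ⊕ x.
Proof. by rewrite oplusC leDl. Qed.

Lemma lambdaP a x : idem a -> x <= a ->
  is_min (complements oplus a x) (lambda a x).
Proof. by move=> ida xa; apply: xgetPex; exact: lambda_min. Qed.

Lemma lambda_le a x : idem a -> x <= a -> lambda a x <= a.
Proof. by move=> ida xa; have [[]] := lambdaP ida xa. Qed.

Lemma lambdaK a x : idem a -> x <= a -> lambda a (lambda a x) = x.
Proof. by move=> ida xa; exact: (MV_negK (emv_MV _ ida)). Qed.

Lemma idem_leD a x y : idem a -> x <= a -> y <= a -> x ⊕ y <= a.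
Proof. by move=> ida xa ya; exact: (MV_op (emv_MV _ ida)). Qed.

Lemma le_lambda a x y : idem a -> x <= a -> y <= a ->
  x <= y <-> lambda a x ⊕ y = a.
Proof.
move=> ida xa ya; have [[lxa lx] _] := lambdaP ida xa; split => [xy|e].
  by apply/le_anti; rewrite idem_leD//= -{1}lx leD.
have [_ /(_ y)] := lambdaP ida lxa; rewrite lambdaK//; apply; split => //.
by rewrite oplusC.
Qed.

Lemma le_residual a x y z : idem a -> x <= a -> y <= a -> z <= a ->
  x <= y ⊕ z <-> lambda a (lambda a x ⊕ y) <= z.
Proof.
move=> ida xa ya za; have lxa := lambda_le ida xa.
have e : lambda a x ⊕ y <= a by exact: idem_leD.
rewrite (le_lambda ida xa (idem_leD ida ya za)).
by rewrite (le_lambda ida (lambda_le ida e) za) lambdaK// oplusA.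
Qed.

Lemma le_oplusI x y z u : u <= x ⊕ y -> u <= x ⊕ z -> u <= x ⊕ (y `&` z).
Proof.
move=> uxy uxz.
have [a ida] := idem_above (u `|` x `|` (y `|` z)).
rewrite !leUx => /andP[/andP[ua xa] /andP[ya za]].
have yza : y `&` z <= a by rewrite leIx2// ya.
apply/(le_residual ida ua xa yza); rewrite lexI.
by apply/andP; split; apply/(le_residual ida ua xa).
Qed.

Lemma meet_oplus z u v : z `&` (u ⊕ v) <= (z `&` u) ⊕ (z `&` v).
Proof.
apply: le_oplusI; first exact: (le_trans (leIl _ _) (leDr _ _)).
rewrite [(z `&` u) ⊕ v]oplusC; apply: le_oplusI.
  exact: (le_trans (leIl _ _) (leDr _ _)).
by rewrite [v ⊕ u]oplusC leIr.
Qed.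

Lemma ideal0 I : ideal I -> I \bot.
Proof. by case=> -[x Ix] Ile _; apply: Ile Ix; exact: le0x. Qed.

Lemma idealT : ideal (setT : set M).
Proof. by split => //; exists \bot. Qed.

Lemma idealI I J : ideal I -> ideal J -> ideal (I `&` J).
Proof.
move=> hI hJ; split.
- by exists \bot; split; exact: ideal0.
- by case: hI hJ => _ Ile _ [_ Jle _] x y xy [/(Ile _ _ xy) ? /(Jle _ _ xy)].
- by case: hI hJ => _ _ ID [_ _ JD] x y [? ?] [? ?]; split; [exact: ID|exact: JD].
Qed.

Definition ideal_gen (G : set M) : set M :=
  [set x | forall J, ideal J -> G `<=` J -> J x].

Lemma ideal_gen_ideal G : ideal (ideal_gen G).
Proof.
split.
- by exists \bot => J hJ _; exact: ideal0.
- by move=> x y xy Gy J hJ GJ; case: (hJ) => _ Jle _; apply: Jle xy _; exact: Gy.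
- by move=> x y Gx Gy J hJ GJ; case: (hJ) => _ _; apply; [exact: Gx|exact: Gy].
Qed.

Lemma sub_ideal_gen G J : ideal J -> ideal_gen G `<=` J <-> G `<=` J.
Proof.
move=> hJ; split => [GJ x Gx|GJ x]; last exact.
by apply: GJ => K _; exact.
Qed.

Lemma maximal_ideal_prime I x y :
  maximal_ideal I -> I (x `&` y) -> I x \/ I y.
Proof.
case=> hI _ Imax Ixy; have [_ Ile ID] := hI.
have [Ix|nIx] := pselect (I x); [by left|right].
pose J : set M := [set z | I (z `&` y)].
have hJ : ideal J.
  split; first by exists x.
    by move=> u v uv; apply: Ile; exact: leI2.
  move=> u v Ju Jv; rewrite /J/= meetC.
  by apply: Ile (meet_oplus _ _ _) _; apply: ID; rewrite meetC.
have IJ : I `<` J.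
  split; first by move=> z; apply: Ile; exact: leIl.
  by move/(_ x Ixy).
have [e|nJT] := pselect (J = setT); last by case: (Imax J hJ nJT).
by have : J y; [rewrite e|rewrite /J/= meetxx].
Qed.

End emv_theory.

(** ** The space of maximal ideals *)

Definition MaxI d (M : emvType d) : Type :=
  set_type [set I : set M | maximal_ideal I].

HB.instance Definition _ d (M : emvType d) := Choice.on (MaxI M).

Definition MaxI_set d (M : emvType d) (A : MaxI M) : set M := val A.

Lemma MaxIP d (M : emvType d) (A : MaxI M) : maximal_ideal (MaxI_set A).
Proof. exact: set_valP. Qed.

Section hull_kernel.
Context d (M : emvType d).

Definition hk (I : set M) : set (MaxI M) := [set A | ~ (I `<=` MaxI_set A)].

Definition hk_open : set (set (MaxI M)) := [set hk I | I in ideal (M := M)].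

Lemma hk_openT : hk_open setT.
Proof.
exists setT; first exact: idealT.
apply/seteqP; split => // A _ /= TA; have [_ nT _] := MaxIP A.
by apply: nT; apply/seteqP; split.
Qed.

Lemma hk_openI : setI_closed hk_open.
Proof.
move=> _ _ [I hI <-] [J hJ <-]; exists (I `&` J); first exact: idealI.
apply/seteqP; split => A /=.
  by move=> nIJ; split=> sub; apply: nIJ => x [Ix Jx]; exact: sub.
move=> [/existsNP[x /not_implyP[Ix nAx]] /existsNP[y /not_implyP[Jy nAy]]] sub.
have [[_ Ile _] [_ Jle _]] := (hI, hJ).
have : MaxI_set A (x `&` y).
  apply: sub; split; first by apply: Ile Ix; exact: leIl.
  by apply: Jle Jy; exact: leIr.
by case/(maximal_ideal_prime (MaxIP A)).
Qed.

Lemma hk_open_bigU (T : Type) (f : T -> set (MaxI M)) :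
  (forall i, hk_open (f i)) -> hk_open (\bigcup_i f i).
Proof.
move=> fop; pose G := \bigcup_(I in [set I | ideal I /\ exists i, f i = hk I]) I.
exists (ideal_gen G); first exact: ideal_gen_ideal.
apply/seteqP; split => A; have [hA _ _] := MaxIP A.
  rewrite /hk/= (sub_ideal_gen G hA) => /existsNP[x /not_implyP[]].
  move=> [I [hI [i fi]] Ix] nAx; exists i => //; rewrite fi => IA.
  by apply: nAx; exact: IA.
move=> [i _]; have [I hI fi] := fop i; rewrite -fi /hk/= => nIA.
rewrite (sub_ideal_gen G hA) => GA; apply: nIA => x Ix.
by apply: GA; exists I => //; split => //; exists i.
Qed.

HB.instance Definition _ :=
  isOpenTopological.Build (MaxI M) hk_openT hk_openI hk_open_bigU.

End hull_kernel.

(** ** The standard MV-algebra on the real unit interval *)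

Definition unit_interval (R : realType) : Type := {i01 R}.

Section unit_interval.
Context (R : realType).
Local Open Scope ring_scope.
Local Notation I01 := (unit_interval R).

HB.instance Definition _ := Order.Total.on I01.

Definition ui_val (x : I01) : R := x%:num.

HB.instance Definition _ := Topological.copy I01 (initial_topology ui_val).

Definition ui0 : I01 := 0%:i01.
Definition ui1 : I01 := 1%:i01.

Lemma ui_ge0 (x : I01) : 0 <= ui_val x.
Proof. by rewrite /ui_val. Qed.

Lemma ui_le1 (x : I01) : ui_val x <= 1.
Proof. by rewrite /ui_val. Qed.

Lemma ui_leE (x y : I01) : (x <= y)%O = (ui_val x <= ui_val y).
Proof. by []. Qed.

Lemma ui_val_inj : injective ui_val.
Proof. exact: val_inj. Qed.

Lemma ui_le0x (x : I01) : (ui0 <= x)%O.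
Proof. by rewrite ui_leE ui_ge0. Qed.

HB.instance Definition _ := Order.hasBottom.Build ring_display I01 ui_le0x.

Lemma ui_oplus_subproof (x y : I01) :
  0 <= Num.min (ui_val x + ui_val y) 1 <= 1.
Proof. by rewrite le_min ge_min lexx orbT ler01 addr_ge0 ?ui_ge0. Qed.

Definition ui_oplus (x y : I01) : I01 :=
  Itv01 (andP (ui_oplus_subproof x y)).1 (andP (ui_oplus_subproof x y)).2.

Lemma ui_oplusE x y : ui_val (ui_oplus x y) = Num.min (ui_val x + ui_val y) 1.
Proof. by []. Qed.

Local Ltac ui_lra :=
  repeat match goal with x : I01 |- _ =>
    move: (ui_ge0 x) (ui_le1 x);
    repeat match goal with H : context[ui_val x] |- _ => move: H end;
    generalize (ui_val x); clear x
  end; intros; lra.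

Lemma ui_oplusA : associative ui_oplus.
Proof.
move=> x y z; apply: ui_val_inj; rewrite !ui_oplusE /Num.min.
case: (ltP (ui_val y + ui_val z) 1) => ?;
  case: (ltP (ui_val x + ui_val y) 1) => ?; by do ![case: ltP => ?]; ui_lra.
Qed.

Lemma ui_oplusC : commutative ui_oplus.
Proof. by move=> x y; apply: ui_val_inj; rewrite !ui_oplusE addrC. Qed.

Lemma ui_oplus0x : left_id (\bot%O : I01) ui_oplus.
Proof.
move=> x; apply: ui_val_inj; rewrite ui_oplusE add0r.
by apply/min_idPl; exact: ui_le1.
Qed.

Lemma ui_le_oplus (z x y : I01) : (x <= y)%O -> (ui_oplus x z <= ui_oplus y z)%O.
Proof.
rewrite !ui_leE !ui_oplusE /Num.min => xy.
by do ![case: ltP => ?]; ui_lra.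
Qed.

Lemma ui_idem (a : I01) : ui_oplus a a = a -> a = ui0 \/ a = ui1.
Proof.
move=> /(congr1 ui_val); rewrite ui_oplusE /Num.min; case: ltP => _ e.
  by left; apply: ui_val_inj; rewrite /ui_val/=; move: e; rewrite /ui_val; lra.
by right; apply: ui_val_inj; rewrite -e.
Qed.

Lemma ui_neg_subproof (x : I01) : 0 <= 1 - ui_val x <= 1.
Proof. by ui_lra. Qed.

Definition ui_neg (x : I01) : I01 :=
  Itv01 (andP (ui_neg_subproof x)).1 (andP (ui_neg_subproof x)).2.

Lemma ui_le0 (x : I01) : (x <= ui0)%O -> x = ui0.
Proof. by move=> x0; apply/le_anti; rewrite x0 ui_le0x. Qed.

Lemma ui_negE x : ui_val (ui_neg x) = 1 - ui_val x.
Proof. by []. Qed.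

Lemma ui_min1 (x : I01) : is_min (complements ui_oplus ui1 x) (ui_neg x).
Proof.
split; first split; first by rewrite ui_leE ui_le1.
  by apply: ui_val_inj; rewrite ui_oplusE ui_negE subrK minxx.
move=> z [_ /(congr1 ui_val)]; rewrite ui_leE ui_oplusE ui_negE /Num.min.
have -> : ui_val ui1 = 1 by [].
by case: ltP => ? ?; ui_lra.
Qed.

Lemma ui_min0 : is_min (complements ui_oplus ui0 ui0) ui0.
Proof.
by split => [|z _]; [split; [|exact: ui_oplus0x]|exact: ui_le0x].
Qed.

Lemma ui_lambda_min (a x : I01) : ui_oplus a a = a -> (x <= a)%O ->
  exists z, is_min (complements ui_oplus a x) z.
Proof.
case/ui_idem => -> => [/ui_le0 ->|_]; last by exists (ui_neg x); exact: ui_min1.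
by exists ui0; exact: ui_min0.
Qed.

Lemma ui_lambda1 x : lambda_of ui_oplus ui1 x = ui_neg x.
Proof.
have [ux xm] := ui_min1 x; apply: xget_unique => // y [uy ym].
by apply/le_anti; rewrite ym// xm.
Qed.

Lemma ui_lambda0 : lambda_of ui_oplus ui0 ui0 = ui0.
Proof.
have [ux xm] := ui_min0; apply: xget_unique => // y [uy ym].
by apply/le_anti; rewrite ym// xm.
Qed.

Lemma ui_MV (a : I01) : ui_oplus a a = a ->
  MV_algebra_on [set x | (x <= a)%O] ui_oplus (lambda_of ui_oplus a) \bot%O a.
Proof.
have ui00 : ui_oplus ui0 ui0 = ui0 by exact: ui_oplus0x.
case/ui_idem => ->.
  split => //=.
  - by move=> x y /ui_le0 -> /ui_le0 ->; rewrite ui00.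
  - by move=> x /ui_le0 ->; rewrite ui_lambda0.
  - by move=> *; exact: ui_oplusA.
  - by move=> *; exact: ui_oplusC.
  - by move=> x _; rewrite ui_oplusC ui_oplus0x.
  - by move=> x /ui_le0 ->; rewrite !ui_lambda0.
  - exact: ui_lambda0.
  - by move=> x /ui_le0 ->.
  - by move=> x y /ui_le0 -> /ui_le0 ->.
have le1 x : (x <= ui1)%O by rewrite ui_leE ui_le1.
split => //=.
- by move=> *; exact: ui_oplusA.
- by move=> *; exact: ui_oplusC.
- by move=> x _; rewrite ui_oplusC ui_oplus0x.
- by move=> x _; rewrite !ui_lambda1; apply: ui_val_inj; rewrite !ui_negE; lra.
- by rewrite ui_lambda1; apply: ui_val_inj; rewrite ui_negE subr0.
- move=> x _; apply: ui_val_inj; rewrite ui_oplusE.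
  by apply/min_idPr; rewrite lerDr ui_ge0.
- move=> x y _ _; rewrite !ui_lambda1; apply: ui_val_inj.
  rewrite !(ui_oplusE, ui_negE) /Num.min.
  case: (ltP (1 - ui_val x + ui_val y) 1) => ?;
    case: (ltP (1 - ui_val y + ui_val x) 1) => ?;
    by do ![case: ltP => ?]; ui_lra.
Qed.

Lemma ui_idem_above (x : I01) : exists2 a, ui_oplus a a = a & (x <= a)%O.
Proof.
exists ui1; last by rewrite ui_leE ui_le1.
by apply: ui_val_inj; apply/min_idPr; rewrite lerDl ler01.
Qed.

HB.instance Definition _ := isEMV.Build ring_display I01
  ui_oplusA ui_oplusC ui_oplus0x ui_le_oplus ui_lambda_min ui_MV ui_idem_above.

End unit_interval.

(** ** State-morphisms *)

Definition state_morphism (R : realType) d (M : emvType d)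
    (s : M -> unit_interval R) : Prop :=
  emv_hom s /\ exists x, s x = ui1 R.

(* [set_type] carries the subspace topology of the product topology on
   [0, 1]^M. *)
Definition SM (R : realType) d (M : emvType d) : Type :=
  set_type [set s : {ptws M -> unit_interval R} | state_morphism s].

HB.instance Definition _ (R : realType) d (M : emvType d) :=
  Topological.copy (SM R M)
    (set_type [set s : {ptws M -> unit_interval R} | state_morphism s]).

Definition SM_fun (R : realType) d (M : emvType d) (s : SM R M) :
  M -> unit_interval R := val s.

Definition Ker (R : realType) d (M : emvType d) (s : M -> unit_interval R) :
  set M := [set x | s x = ui0 R].

Definition homeomorphism (X Y : topologicalType) (f : X -> Y) : Prop :=
  continuous f /\
  exists g : Y -> X, [/\ continuous g, cancel f g & cancel g f].

(* Main.v *)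
Require Import Defs.
From HB Require Import structures.
From mathcomp Require Import all_boot all_order all_algebra.
From mathcomp Require Import all_classical all_reals all_analysis.
From mathcomp Require Import lra zify.

(** A state-morphism [s] is determined by its kernel because doubling magnifies
    differences: if [s x] and [t x] are both below 1/2, then [s (x + x)] and
    [t (x + x)] differ twice as much, and elements above 1/2 are first reflected
    by a relative complement [lambda b x]. Which side of 1/2 a value lies on is
    itself visible in the kernel. Quantitatively ([state_approx]), for every
    [n] the non-vanishing of [t] at one suitable element already forces [t x]
    to lie within [2^-n] of [s x]. This single statement gives the injectivity
    of [s |-> Ker s] ([state_eq]) and the continuity of its inverse, since the
    ideals that omit a given element form an open set. The continuity of the map
    itself is immediate: that [Ker s] does not contain an ideal [I] is the union
    over [x] in [I] of the open conditions [s x != 0].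

    For surjectivity ([maximal_ideal_state]), let [A] be a maximal ideal. The
    quotient [M / A] has a top element, the common class of all idempotents
    outside [A]; it is an MV-algebra, it is a chain because [A] is prime and
    [M] is prelinear, and it is archimedean because [A] is maximal. Such a
    chain embeds in [0, 1] ([mv_chain_embedding]). The embedding is obtained in
    the spirit of Chang and Hoelder: in the positive cone of the Chang group, in
    which the top is a unit [1], the integral part of [n x] is additive in [n]
    up to one unit, so it grows with a well-defined slope, the value of the
    embedding at [x].

    The equivalences rest on one extension result: an ideal that misses an
    idempotent [c] is contained in a maximal ideal that misses [c]
    ([maximal_ideal_separation]). If [M] has a top [t], then for a proper filter
    on the space of maximal ideals the elements that lie in almost every ideal
    form an ideal without [t], and a maximal ideal above it is a cluster point.
    Conversely, if no idempotent [a] is a top, then the sets of maximal ideals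
    containing [a] generate a proper filter, which has no cluster point because
    every maximal ideal omits some idempotent. Compactness passes from one
    space to the other along the homeomorphism. *)

Set Implicit Arguments.
Unset Strict Implicit.
Unset Printing Implicit Defensive.

Import Order.TTheory GRing.Theory Num.Theory.
Import numFieldNormedType.Exports.

Local Open Scope classical_set_scope.

(** * Embedding an archimedean MV-chain in the unit interval *)

(** A sequence that is additive up to one unit grows linearly: no [f m / m]
    exceeds any [(f n + 1) / n], so the supremum of the [f m / m] is a slope. *)
Lemma quasi_additive_slope (R : realType) (f : nat -> nat) :
  (forall m n, f m + f n <= f (m + n) <= (f m + f n).+1)%N ->
  exists s : R, forall n, ((f n)%:R <= n%:R * s <= (f n).+1%:R)%R.
Proof.
move=> fD; have f0 : f 0%N = 0%N.
  by have := fD 0%N 0%N; rewrite [(0 + 0)%N]addn0; lia.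
have fM m n : (n > 0)%N -> (n * f m <= f (n * m) <= n * (f m).+1 - 1)%N.
  case: n => // n _; elim: n => [|n IH]; first by rewrite !mul1n; lia.
  by have := fD m (n.+1 * m)%N; rewrite -[(n.+2 * m)%N]/(m + n.+1 * m)%N; nia.
(* both sides are compared with [f (n * m)] *)
have fle m n : (n * f m <= m * (f n).+1)%N.
  case: n => [|n]; first by rewrite mul0n.
  case: m => [|m]; first by rewrite f0 muln0.
  have := fM m.+1 n.+1 isT; have := fM n.+1 m.+1 isT.
  by rewrite [(n.+1 * m.+1)%N]mulnC; lia.
pose E : set R := [set ((f m.+1)%:R / m.+1%:R)%R | m in [set: nat]].
have Eub n : ubound E ((f n.+1).+1%:R / n.+1%:R)%R.
  move=> _ [m _ <-]; rewrite ler_pdivrMr ?ltr0n // mulrAC ler_pdivlMr ?ltr0n //.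
  by rewrite -!natrM ler_nat mulnC [leqRHS]mulnC fle.
have E0 : E !=set0 by exists ((f 1%N)%:R / 1%:R)%R; exists 0%N.
exists (sup E); case=> [|n]; first by rewrite f0 mul0r lexx ler01.
rewrite mulrC; apply/andP; split.
  rewrite -ler_pdivrMr ?ltr0n //; apply: ub_le_sup; last by exists n.
  by exists ((f 1%N).+1%:R / 1%:R)%R; exact: Eub.
by rewrite -ler_pdivlMr ?ltr0n //; apply: ge_sup => //; exact: Eub.
Qed.

Lemma bounded_mul_eq0 (R : realType) (x K : R) :
  (forall n, (n%:R * `|x| <= K)%R) -> x = 0%R.
Proof.
move=> xK; apply/eqP; rewrite -normr_eq0 -[_ == _]negbK; apply/negP => x0.
have xp : (0 < `|x|)%R by rewrite lt_def x0 normr_ge0.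
have /archi_boundP : (0 <= K / `|x|)%R.
  by rewrite divr_ge0 ?normr_ge0 // -(mul0r `|x|)%R; exact: (xK 0%N).
by rewrite ltr_pdivrMr // ltNge xK.
Qed.

Section mv_chain.
Variables (T : Type) (op : T -> T -> T) (neg : T -> T) (zero one : T).
Hypothesis mv : MV_algebra_on [set: T] op neg zero one.

Local Notation "x ⊕ y" := (op x y) (at level 50, left associativity).
Local Notation "¬ x" := (neg x) (at level 35, right associativity).
Local Notation "x ⊙ y" := (neg (op (neg x) (neg y)))
  (at level 40, left associativity).

Let opA x y z : x ⊕ (y ⊕ z) = x ⊕ y ⊕ z. Proof. exact: (MV_opA mv). Qed.
Let opC x y : x ⊕ y = y ⊕ x. Proof. exact: (MV_opC mv). Qed.
Let op0 x : x ⊕ zero = x. Proof. exact: (MV_op0 mv). Qed.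
Let op1 x : x ⊕ one = one. Proof. exact: (MV_op1 mv). Qed.
Let negK x : ¬ ¬ x = x. Proof. exact: (MV_negK mv). Qed.
Let neg0 : ¬ zero = one. Proof. exact: (MV_neg0 mv). Qed.
Let neg1 : ¬ one = zero. Proof. by rewrite -neg0 negK. Qed.
Let luk x y : ¬ (¬ x ⊕ y) ⊕ y = ¬ (¬ y ⊕ x) ⊕ x.
Proof. exact: (MV_luk mv). Qed.
Let op1l x : one ⊕ x = one. Proof. by rewrite opC op1. Qed.
Let op0l x : zero ⊕ x = x. Proof. by rewrite opC op0. Qed.

Lemma mv_negl x : ¬ x ⊕ x = one.
Proof. by have := luk one x; rewrite neg1 op0l op1. Qed.

Lemma mv_add_eq0 x y : x ⊕ y = zero -> x = zero.
Proof.
by move=> e; rewrite -[x]negK -[¬ x]op0 -e opA mv_negl op1l neg1.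
Qed.

(** Nothing is lost in [x ⊙ y] when the sum of [x] and [y] reaches the top: it
    is [x + y - 1], so [x] is recovered by adding back [1 - y]. *)
Lemma mv_times_add x y : x ⊕ y = one -> (x ⊙ y) ⊕ ¬ y = x.
Proof. by move=> xy; rewrite luk negK [y ⊕ x]opC xy neg1 op0l. Qed.

(** Dually, nothing is truncated in [x ⊕ y] when [x] and [y] sum to at most the
    top, so [y] can be subtracted again. *)
Lemma mv_add_times x y : x ⊙ y = zero -> (x ⊕ y) ⊙ ¬ y = x.
Proof.
move=> xy; rewrite negK -[in LHS](negK x) luk [¬ y ⊕ _]opC xy.
by rewrite op0l negK.
Qed.

Lemma mv_times_eq0 x y : x ⊙ y = zero -> ¬ x ⊕ ¬ y = one.
Proof. by move=> e; rewrite -[LHS]negK e neg0. Qed.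

Lemma mv_timesA x y z : (x ⊙ y) ⊙ z = x ⊙ (y ⊙ z).
Proof. by rewrite !negK opA. Qed.

Lemma mv_times_under x y z : y ⊙ z = zero -> (x ⊙ y) ⊙ z = zero.
Proof. by rewrite mv_timesA => ->; rewrite neg0 op1 neg1. Qed.

(** This law and the next two equate two ways of computing [x + y + z - 1] in
    the Chang group, truncated to the unit interval; they carry the
    associativity of [cone_add]. *)
Lemma mv_assoc_over x y z : x ⊕ y = one -> y ⊕ z = one ->
  (x ⊙ y) ⊕ z = x ⊕ (y ⊙ z).
Proof.
move=> xy yz; rewrite -[in RHS](mv_times_add xy) -opA.
by rewrite [¬ y ⊕ _]opC [¬ y ⊕ ¬ z]opC mv_times_add // opC.
Qed.

Lemma mv_assoc_under x y z : x ⊙ y = zero -> y ⊙ z = zero ->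
  (x ⊕ y) ⊙ z = x ⊙ (y ⊕ z).
Proof.
move=> /mv_times_eq0 xy /mv_times_eq0 yz; congr neg.
by have := mv_assoc_over xy yz; rewrite !negK.
Qed.

Lemma mv_assoc_mixed x y z : x ⊕ y = one -> y ⊙ z = zero ->
  (x ⊙ y) ⊕ z = x ⊙ (y ⊕ z).
Proof.
move=> xy yz; set t := ¬ (y ⊕ z).
have nyE : z ⊕ t = ¬ y.
  have := @mv_times_add (¬ y) (¬ z); rewrite !negK => e.
  by rewrite /t opC e //; exact: mv_times_eq0.
have xE : x = (x ⊙ y) ⊕ z ⊕ t by rewrite -opA nyE mv_times_add.
rewrite -[RHS](_ : (x ⊙ y ⊕ z ⊕ t) ⊙ ¬ t = _); last by rewrite -xE /t negK.
rewrite mv_add_times //.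
have yzE : ¬ t = (x ⊙ y) ⊕ z ⊕ ¬ x.
  have yx : y ⊕ x = one by rewrite opC.
  rewrite /t negK -[in LHS](mv_times_add yx) [¬ y ⊕ _]opC.
  by rewrite -[LHS]opA -[RHS]opA [¬ x ⊕ z]opC.
by rewrite yzE opA mv_negl op1l neg1.
Qed.

(** The pair [(q, r)] stands for the element [q + r] of the positive cone of the
    Chang group, in which [one] is the unit. A unit is carried only when
    [p.2 ⊙ p'.2] is nonzero, that is, when the sum of the fractional parts
    strictly exceeds the unit; the pairs generated by the [(0, x)] are thus
    [(0, zero)] and pairs with [0 < r <= 1]. Carrying already at equality would
    spoil the neutrality of [(0, zero)] for [(0, one)]. *)
Definition cone_add (p p' : nat * T) : nat * T :=
  if `[< p.2 ⊙ p'.2 = zero >] then ((p.1 + p'.1)%N, p.2 ⊕ p'.2)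
  else ((p.1 + p'.1).+1, p.2 ⊙ p'.2).

Lemma cone_addC : commutative cone_add.
Proof.
by move=> p p'; rewrite /cone_add addnC [p.2 ⊕ _]opC [¬ p.2 ⊕ _]opC.
Qed.

Lemma cone_add_under (p p' : nat * T) : p.2 ⊙ p'.2 = zero ->
  cone_add p p' = ((p.1 + p'.1)%N, p.2 ⊕ p'.2).
Proof. by move=> e; rewrite /cone_add asboolT. Qed.

Lemma cone_add_over (p p' : nat * T) : p.2 ⊙ p'.2 <> zero ->
  cone_add p p' = ((p.1 + p'.1).+1, p.2 ⊙ p'.2).
Proof. by move=> e; rewrite /cone_add asboolF. Qed.

Lemma cone_add0 : left_id (0%N, zero) cone_add.
Proof.
move=> [q r]; rewrite cone_add_under /= ?op0l //.
by rewrite neg0 op1l neg1.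
Qed.

Lemma cone_add_carry p p' :
  (p.1 + p'.1 <= (cone_add p p').1 <= (p.1 + p'.1).+1)%N.
Proof. by rewrite /cone_add; case: ifP => _ /=; rewrite leqnn leqnSn. Qed.

Hypothesis total : forall x y, ¬ x ⊕ y = one \/ ¬ y ⊕ x = one.

(** The only use of totality: a carry supplies the hypothesis [x ⊕ y = one] of
    the laws [mv_assoc_over] and [mv_assoc_mixed]. *)
Lemma mv_over x y : x ⊙ y <> zero -> x ⊕ y = one.
Proof.
move=> xy; have [e|] := total x (¬ y); first by case: xy; rewrite e neg1.
by rewrite negK opC.
Qed.

Lemma cone_addA : associative cone_add.
Proof.
(* the two cases with exactly one carry are mirror images *)
suff mixed p q r : p.2 ⊙ q.2 <> zero -> q.2 ⊙ r.2 = zero ->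
    cone_add p (cone_add q r) = cone_add (cone_add p q) r.
  move=> p q r.
  have [pq|pq] := pselect (p.2 ⊙ q.2 = zero);
    have [qr|qr] := pselect (q.2 ⊙ r.2 = zero).
  - rewrite (cone_add_under pq) (cone_add_under qr) /cone_add /=.
    by rewrite mv_assoc_under // addnA opA.
  - rewrite [RHS]cone_addC [cone_add p q]cone_addC [RHS]mixed.
    + by rewrite [RHS]cone_addC [cone_add r q]cone_addC.
    + by rewrite [¬ r.2 ⊕ _]opC.
    + by rewrite [¬ q.2 ⊕ _]opC.
  - exact: mixed.
  - rewrite (cone_add_over pq) (cone_add_over qr) /cone_add /=.
    rewrite mv_timesA (mv_assoc_over (mv_over pq) (mv_over qr)).
    by rewrite !addnS addSn addnA.
move=> pq qr; rewrite (cone_add_over pq) (cone_add_under qr).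
have e := mv_assoc_mixed (mv_over pq) qr.
rewrite cone_add_over /= -?e; last by move=> /mv_add_eq0.
by rewrite cone_add_under /= ?mv_times_under // addSn addnA.
Qed.

Definition cone_mul n p := iter n (cone_add p) (0%N, zero).

Lemma cone_mulDl m n p :
  cone_mul (m + n) p = cone_add (cone_mul m p) (cone_mul n p).
Proof.
elim: m => [|m IH]; first by rewrite cone_add0.
by rewrite addSn [LHS]/= -/(cone_mul _ p) IH cone_addA.
Qed.

Lemma cone_mulDr n p p' :
  cone_mul n (cone_add p p') = cone_add (cone_mul n p) (cone_mul n p').
Proof.
elim: n => [|n IH]; first by rewrite cone_add0.
rewrite [LHS]/= -/(cone_mul _ _) IH -!cone_addA; congr cone_add.
by rewrite cone_addA [cone_add p' _]cone_addC -!cone_addA.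
Qed.

Lemma cone_mul_shift n q r :
  cone_mul n (q, r) =
    ((n * q + (cone_mul n (0, r)).1)%N, (cone_mul n (0, r)).2).
Proof.
elim: n => [|n IH] //.
rewrite [in LHS]/= -/(cone_mul _ _) IH /= -/(cone_mul n (0, r)) /cone_add /=.
by case: ifP => _ /=; rewrite mulSn add0n ?addnS addnA.
Qed.

Hypothesis nontrivial : zero <> one.

Lemma mv_timesx1 x : x ⊙ one = x.
Proof. by rewrite neg1 op0 negK. Qed.

Hypothesis archimedean :
  forall x, x <> zero -> exists n, iter n (op x) zero = one.

(** As long as no unit is carried, multiples in the cone are the multiples in
    the chain, and these reach the top; the next multiple then carries. *)
Lemma cone_mul_unbounded x : x <> zero -> exists n, (0 < (cone_mul n (0, x)).1)%N.
Proof.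
move=> x0; have [n nx] := archimedean x0; exists n.+1.
rewrite ltnNge leqn0; apply/negP => /eqP e.
suff mulE m : (cone_mul m (0, x)).1 = 0%N ->
    cone_mul m (0, x) = (0%N, iter m (op x) zero).
  move: (e); rewrite [cone_mul _ _]/= -/(cone_mul _ _).
  rewrite mulE; last first.
    move: e; rewrite [cone_mul _ _]/= -/(cone_mul _ _).
    by have := cone_add_carry (0%N, x) (cone_mul n (0%N, x)); lia.
  by rewrite nx cone_add_over //= mv_timesx1.
elim: m => [//|m IH]; rewrite [cone_mul _ _]/= -/(cone_mul _ _) => e1.
have := cone_add_carry (0%N, x) (cone_mul m (0%N, x)); rewrite e1.
move=> b; move: e1; rewrite IH; last by lia.
by rewrite /cone_add; case: ifP => _.
Qed.

(** The value [h x] is the slope of the integral part of [n x] in the cone.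
    Additivity up to a bounded error for each [n] becomes additivity of the
    slopes, [h x + h y = c + h w] with [c] the unit carried by [x + y]. *)
Theorem mv_chain_embedding (R : realType) : exists h : T -> R,
  [/\ forall x, (0 <= h x <= 1)%R,
      forall x y, h (x ⊕ y) = Num.min (h x + h y)%R 1%R,
      forall x, h (¬ x) = (1 - h x)%R,
      h one = 1%R
    & forall x, h x = 0%R -> x = zero].
Proof.
pose f x n := (cone_mul n (0, x)).1.
have fD x m n : (f x m + f x n <= f x (m + n) <= (f x m + f x n).+1)%N.
  by rewrite /f cone_mulDl cone_add_carry.
have [h hP] := choice (fun x => quasi_additive_slope R (fD x)).
have hD x y c w : cone_add (0, x) (0, y) = (c, w) -> (h x + h y = c%:R + h w)%R.
  move=> xyE.
  (* multiplying [x + y = c + w] by [n] and taking integral parts *)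
  have fE n : (f x n + f y n <= n * c + f w n <= (f x n + f y n).+1)%N.
    have := cone_mulDr n (0, x) (0, y); rewrite xyE cone_mul_shift.
    move=> /(congr1 fst) /= ->; exact: cone_add_carry.
  apply/eqP; rewrite -subr_eq0; apply/eqP; apply: (@bounded_mul_eq0 _ _ 4%R) => n.
  rewrite -[n%:R%R]normr_nat -normrM ler_norml.
  have /andP[x1 x2] := hP x n; have /andP[y1 y2] := hP y n.
  have /andP[w1 w2] := hP w n; have /andP[] := fE n.
  rewrite -!(ler_nat R) !(natrD, natrM, mulrS) in x1 x2 y1 y2 w1 w2 *.
  by move=> e1 e2; apply/andP; split; lra.
have hU x y : x ⊙ y = zero -> (h x + h y = h (x ⊕ y))%R.
  by move=> xy; rewrite (@hD _ _ 0%N (x ⊕ y)) ?add0r // cone_add_under.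
have hO x y : x ⊙ y <> zero -> (h x + h y = 1 + h (x ⊙ y))%R.
  by move=> xy; rewrite (@hD _ _ 1%N (x ⊙ y)) // cone_add_over.
have hge0 x : (0 <= h x <= 1)%R.
  by have := hP x 1%N; rewrite /f /= cone_addC cone_add0 mul1r.
have h0 : h zero = 0%R.
  have := hU zero zero; rewrite op0 neg0 op1 neg1 => /(_ erefl); lra.
have h1 : h one = 1%R.
  have := hO one one; rewrite mv_timesx1 => /(_ (nesym nontrivial)); lra.
exists h; split=> //.
- move=> x y; have [xy|xy] := pselect (x ⊙ y = zero).
    by rewrite (hU _ _ xy); apply/esym/min_idPl; have /andP[] := hge0 (x ⊕ y).
  rewrite (mv_over xy) h1; apply/esym/min_idPr; rewrite (hO _ _ xy).
  by have := hge0 (x ⊙ y); lra.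
- move=> x; have := hU x (¬ x); rewrite negK [¬ x ⊕ x]mv_negl neg1.
  by move=> /(_ erefl); rewrite opC mv_negl h1; lra.
- move=> x hx; have [//|/cone_mul_unbounded[n]] := pselect (x = zero).
  by have /andP[] := hP x n; rewrite hx mulr0 lern0 -/(f x n) => /eqP ->.
Qed.

End mv_chain.

Local Open Scope order_scope.
Local Open Scope emv_scope.

(** * Arithmetic, prelinearity and ideal separation in an EMV-algebra *)

Section emv_arithmetic.
Context d (M : emvType d).
Implicit Types (x y z u v w a b c m : M) (I J : set M).

Lemma lambda_oplus a x : idem a -> x <= a -> lambda a x ⊕ x = a.
Proof. by move=> ida xa; have [[]] := lambdaP ida xa. Qed.

Lemma lambda0 a : idem a -> lambda a \bot = a.
Proof. by move=> ida; exact: (MV_neg0 (emv_MV _ ida)). Qed.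

Lemma lambda_self a : idem a -> lambda a a = \bot.
Proof. by move=> ida; rewrite -{2}(lambda0 ida) lambdaK. Qed.

Lemma lambda_luk a x y : idem a -> x <= a -> y <= a ->
  lambda a (lambda a x ⊕ y) ⊕ y = lambda a (lambda a y ⊕ x) ⊕ x.
Proof. by move=> ida xa ya; exact: (MV_luk (emv_MV _ ida)). Qed.

(** No truncation occurs in [m ⊕ w] when [w] lies below the complement of [m],
    so [m] can be subtracted again. *)
Lemma oplus_cancel a m w : idem a -> m <= a -> w <= lambda a m ->
  lambda a (lambda a (m ⊕ w) ⊕ m) = w.
Proof.
move=> ida ma wl; have wa : w <= a by exact: le_trans (lambda_le ida ma).
have lwa := lambda_le ida wa.
have lmlw : lambda a m ⊕ lambda a w = a.
  by rewrite oplusC; apply/(le_lambda ida wa (lambda_le ida ma)).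
have := lambda_luk ida lwa ma; rewrite lambdaK // lmlw lambda_self // oplus0x.
by rewrite [m ⊕ w]oplusC => ->; rewrite lambdaK.
Qed.

Lemma oplus_absorb0 a m w : idem a -> m <= a -> w <= lambda a m ->
  m ⊕ w <= m -> w = \bot.
Proof.
move=> ida ma wl mw; apply/le_anti; rewrite le0x andbT.
rewrite -(oplus_cancel ida ma wl); apply/le_residual => //.
- by apply: idem_leD => //; exact: le_trans (lambda_le ida ma).
- by rewrite oplusx0.
Qed.

Lemma idem_meet_lambda a c w : idem a -> idem c -> c <= a ->
  w <= c -> w <= lambda a c -> w = \bot.
Proof.
move=> ida idc ca wc wl; apply: (oplus_absorb0 ida ca wl).
by rewrite -[leRHS]idc leD.
Qed.

(** The truncated differences [x - y] and [y - x] are disjoint: with [m] the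
    meet of [x] and [y], an element [w] below both differences satisfies
    [m ⊕ w <= x] and [m ⊕ w <= y], hence [m ⊕ w <= m], so it vanishes by
    cancellation. *)
Lemma prelinear a x y : idem a -> x <= a -> y <= a ->
  lambda a (lambda a x ⊕ y) `&` lambda a (lambda a y ⊕ x) = \bot.
Proof.
move=> ida; set m := x `&` y; set w := _ `&` _.
suff half u v : u <= a -> v <= a ->
    lambda a (lambda a u ⊕ v) ⊕ (u `&` v) <= u /\
    lambda a (lambda a u ⊕ v) <= lambda a (u `&` v).
  move=> xa ya; have [wx wm] := half x y xa ya; have [wy _] := half y x ya xa.
  have ma : m <= a by rewrite (le_trans (leIl _ _)).
  apply: (oplus_absorb0 ida ma); first by rewrite (le_trans (leIl _ _)).
  rewrite lexI; apply/andP; split.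
    by rewrite oplusC (le_trans _ wx) // le_oplus // leIl.
  by rewrite oplusC (le_trans _ wy) // [y `&` x]meetC le_oplus // leIr.
move=> ua va; set n := u `&` v.
have na : n <= a by rewrite (le_trans (leIl _ _)).
have lna := lambda_le ida na.
have lua := lambda_le ida ua.
have lun : lambda a (lambda a u ⊕ n) <= a by rewrite lambda_le // idem_leD.
have un : lambda a (lambda a u ⊕ v) <= lambda a (lambda a u ⊕ n).
  apply/le_residual => //; apply: (@le_trans _ _ (n ⊕ lambda a (lambda a u ⊕ n))).
    by apply/(le_residual ida ua na lun).
  by apply: le_oplus; exact: leIr.
split.
  apply: (le_trans (le_oplus _ _ _ un)); rewrite lambda_luk //.
  have /(le_lambda ida na ua) -> : n <= u by exact: leIl.
  by rewrite lambda_self // oplus0x.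
apply: (le_trans un); apply/le_residual => //.
by rewrite oplusC lambda_oplus.
Qed.

Lemma idem_above2 x y : exists b, [/\ idem b, x <= b & y <= b].
Proof.
have [b idb] := idem_above (x `|` y); rewrite leUx => /andP[xb yb].
by exists b.
Qed.

Definition multiple (n : nat) x := iter n (oplus x) \bot.

Lemma multipleD (k n : nat) x : multiple (k + n) x = multiple k x ⊕ multiple n x.
Proof.
elim: k => [|k IH]; first by rewrite oplus0x.
by rewrite addSn /= IH oplusA.
Qed.

Lemma multiple_idem (n : nat) c : idem c -> multiple n c <= c.
Proof. by move=> idc; elim: n => [|n IH]; rewrite /= ?le0x // idem_leD. Qed.

Lemma ideal_le I x y : ideal I -> x <= y -> I y -> I x.
Proof. by case=> _ Ile _; exact: Ile. Qed.

Lemma idealD I x y : ideal I -> I x -> I y -> I (x ⊕ y).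
Proof. by case=> _ _; exact. Qed.

(** Zorn's lemma gives an ideal [A] that is maximal among those that miss [c].
    It is maximal among all proper ideals because it contains every element
    disjoint from [c]: otherwise the ideal of those [x] with [x `&` c] in [A]
    would be larger and still miss [c]. So an ideal properly above [A] contains
    [c] and all elements disjoint from [c], and these generate [M]. *)
Lemma maximal_ideal_separation I c : ideal I -> idem c -> ~ I c ->
  exists A, [/\ maximal_ideal A, I `<=` A & ~ A c].
Proof.
move=> hI idc Ic.
(* the empty set is admitted as the union of the empty chain *)
pose P (J : set M) := J = set0 \/ [/\ ideal J, I `<=` J & ~ J c].
have [F FP Ftot|A [PA Amax]] := @Zorn_bigcup _ P.
  have [[J [FJ J0]]|F0] := pselect (exists J, F J /\ J !=set0); last first.
    left; apply/seteqP; split => // x [J FJ Jx]; case: F0.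
    by exists J; split => //; exists x.
  have FI K x : F K -> K x -> [/\ ideal K, I `<=` K & ~ K c].
    by move=> FK Kx; case: (FP _ FK) => // K0; move: Kx; rewrite K0.
  case: J0 => j Jj; have [hJ IJ Jc] := FI _ _ FJ Jj.
  right; split.
  - split.
    + by exists j, J.
    + move=> x y xy [K FK Ky]; exists K => //.
      by have [hK _ _] := FI _ _ FK Ky; exact: ideal_le xy Ky.
    + move=> x y [K FK Kx] [L FL Ly].
      have [hK _ _] := FI _ _ FK Kx; have [hL _ _] := FI _ _ FL Ly.
      have [KL|LK] := Ftot _ _ FK FL.
        by exists L => //; apply: idealD => //; exact: KL.
      by exists K => //; apply: idealD => //; exact: LK.
  - by move=> x Ix; exists J => //; exact: IJ.
  - by move=> [K FK Kc]; have [_ _] := FI _ _ FK Kc.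
have {PA} [hA IA Ac] : [/\ ideal A, I `<=` A & ~ A c].
  case: PA => // A0; case: (Amax I); last by right; split.
  by rewrite A0; split; [exact: sub0set|move=> /(_ _ (ideal0 hI))].
exists A; split => //; split => //.
  by move=> AT; apply: Ac; rewrite AT.
move=> J hJ JT AJ.
have Jc : J c.
  apply: contrapT => Jc; apply: (Amax J AJ); right; split => //.
  by apply: subset_trans IA _; case: AJ.
have disj y : y `&` c = \bot -> A y.
  move=> yc; apply: contrapT => Ay.
  pose K := [set x | A (x `&` c)].
  apply: (Amax K).
    split; first by move=> x; exact: (ideal_le hA (leIl x c)).
    by move=> /(_ y); rewrite /K /= yc => /(_ (ideal0 hA)).
  right; split.
  - split.
    + by exists y; rewrite /K /= yc; exact: ideal0.
    + by move=> u v uv; exact: (ideal_le hA (leI2 uv (lexx c))).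
    + move=> u v Ku Kv; rewrite /K /= meetC.
      apply: (ideal_le hA (meet_oplus _ _ _)).
      by rewrite ![c `&` _]meetC; exact: idealD.
  - move=> x Ix; rewrite /K /=; apply: (ideal_le hA (leIl _ _)); exact: IA.
  - by rewrite /K /= meetxx.
apply: JT; apply/seteqP; split => // y _.
have [b [idb yb cb]] := idem_above2 y c.
have lcb := lambda_le idb cb.
apply: (@ideal_le _ _ (c ⊕ (y `&` lambda b c)) hJ); last first.
  apply: idealD => //; case: AJ => AJ _; apply: AJ; apply: disj.
  apply: (idem_meet_lambda idb idc cb); first exact: leIr.
  by apply: le_trans (leIl _ _) (leIr _ _).
apply: (@le_trans _ _ (y `&` (c ⊕ lambda b c))).
  by rewrite oplusC lambda_oplus // lexI lexx.
by apply: (le_trans (meet_oplus _ _ _)); apply: le_oplus; exact: leIr.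
Qed.

End emv_arithmetic.

(** * The quotient by a maximal ideal *)

Section maximal_quotient.
Context d (M : emvType d) (A : set M).
Hypothesis hmax : maximal_ideal A.
Implicit Types (x y z u v w a b c m : M).

Let hA : ideal A. Proof. by case: hmax. Qed.

(** The order of the quotient [M / A], pulled back to [M]. *)
Definition le_mod x y := exists2 z, A z & x <= y ⊕ z.

Lemma le_mod_le x y : x <= y -> le_mod x y.
Proof. by move=> xy; exists \bot; rewrite ?oplusx0 //; exact: ideal0. Qed.

Lemma le_mod_refl x : le_mod x x. Proof. exact: le_mod_le. Qed.

Lemma le_mod_trans y x z : le_mod x y -> le_mod y z -> le_mod x z.
Proof.
move=> [u Au xy] [v Av yz]; exists (v ⊕ u); first exact: idealD.
by rewrite oplusA (le_trans xy) // le_oplus.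
Qed.

Lemma le_modD x y u v : le_mod x y -> le_mod u v -> le_mod (x ⊕ u) (y ⊕ v).
Proof.
move=> [s As xy] [t At uv]; exists (s ⊕ t); first exact: idealD.
apply: (le_trans (leD xy uv)); rewrite -!oplusA; apply: leD => //.
by rewrite !oplusA [s ⊕ v]oplusC.
Qed.

Lemma le_mod0 x : A x <-> le_mod x \bot.
Proof.
split => [Ax|[z Az]]; first by exists x; rewrite ?oplus0x.
by rewrite oplus0x => /(ideal_le hA); apply.
Qed.

Lemma le_modI x y z : le_mod x y -> le_mod x z -> le_mod x (y `&` z).
Proof.
move=> [u Au xy] [v Av xz]; exists (u ⊕ v); first exact: idealD.
rewrite oplusC; apply: le_oplusI; rewrite oplusC.
  by apply: (le_trans xy); apply: leD => //; exact: leDl.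
by apply: (le_trans xz); apply: leD => //; exact: leDr.
Qed.

Lemma le_modU x y z : le_mod x z -> le_mod y z -> le_mod (x `|` y) z.
Proof.
move=> [u Au xz] [v Av yz]; exists (u ⊕ v); first exact: idealD.
rewrite leUx; apply/andP; split.
  by apply: (le_trans xz); apply: leD => //; exact: leDl.
by apply: (le_trans yz); apply: leD => //; exact: leDr.
Qed.

(** One of the two disjoint differences of [x] and [y] lies in the prime ideal
    [A]. *)
Lemma le_mod_total x y : le_mod x y \/ le_mod y x.
Proof.
have [b [idb xb yb]] := idem_above2 x y.
have := prelinear idb xb yb; set u := lambda b _; set v := lambda b (_ ⊕ x).
have ub : u <= b by rewrite lambda_le // idem_leD // lambda_le.
have vb : v <= b by rewrite lambda_le // idem_leD // lambda_le.
move=> uv; have : A (u `&` v) by rewrite uv; exact: ideal0.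
move=> /(maximal_ideal_prime hmax)[Au|Av]; [left; exists u|right; exists v] => //.
  by apply/(le_residual idb xb yb ub).
by apply/(le_residual idb yb xb vb).
Qed.

(** The quotient is simple: the elements below a multiple of [x] modulo [A] form
    an ideal that properly contains [A]. *)
Lemma le_mod_multiple x y : ~ A x -> exists n, le_mod y (multiple n x).
Proof.
move=> Ax; pose J := [set y | exists n, le_mod y (multiple n x)].
suff : J = setT by move=> JT; have : J y by rewrite JT.
apply: contrapT => JT; have [_ _ Amax] := hmax; apply: (Amax J) => //.
  split.
  - by exists \bot, 0%N; exact: le_mod_refl.
  - move=> u v uv [n vn]; exists n; apply: le_mod_trans vn; exact: le_mod_le.
  - by move=> u v [m um] [n vn]; exists (m + n)%N; rewrite multipleD; exact: le_modD.
split; first by move=> z Az; exists 0%N; apply/le_mod0.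
move=> /(_ x); apply: contra_not Ax; apply; exists 1%N.
by rewrite /multiple /= oplusx0; exact: le_mod_refl.
Qed.

(** All idempotents outside [A] have the same class, the top of the quotient. *)
Lemma le_mod_idem b x : idem b -> ~ A b -> le_mod x b.
Proof.
move=> idb Ab; have [n xn] := le_mod_multiple x Ab.
by apply: le_mod_trans xn _; apply: le_mod_le; exact: multiple_idem.
Qed.

Lemma idem_outside : exists2 a, idem a & ~ A a.
Proof.
have [_ AT _] := hmax.
have /existsNP[x Ax] : ~ forall x, A x.
  by move=> Aall; apply: AT; apply/seteqP; split.
have [a ida xa] := idem_above x; exists a => // Aa.
by apply: Ax; exact: ideal_le xa Aa.
Qed.

Lemma idem_outside2 x y : exists b, [/\ idem b, ~ A b, x <= b & y <= b].
Proof.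
have [a ida Aa] := idem_outside; have [b [idb xyb ab]] := idem_above2 (x `|` y) a.
move: xyb; rewrite leUx => /andP[xb yb]; exists b; split => //.
by apply: contra_not Aa; exact: ideal_le.
Qed.

(** This adjunction characterises the class of [lambda b x] in terms that, for [b]
    outside [A], do not depend on [b]; so negation is well defined on the
    quotient although [M] has only relative complements. *)
Lemma lambda_mod b x w : idem b -> x <= b ->
  le_mod (lambda b x) w <-> le_mod b (x ⊕ w).
Proof.
move=> idb xb; split => [lw|[z Az bz]].
  rewrite -(lambda_oplus idb xb) oplusC.
  by apply: le_modD => //; exact: le_mod_refl.
exists z => //; have lb := lambda_le idb xb.
apply: (@le_trans _ _ (b `&` (w ⊕ z))); last exact: leIr.
have wb : b `&` (w ⊕ z) <= b by exact: leIl.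
apply/(le_lambda idb lb wb); rewrite lambdaK //.
apply/le_anti; rewrite idem_leD //=.
by apply: le_oplusI; [exact: leDr|rewrite oplusA].
Qed.

Definition eq_mod x y := `[< le_mod x y /\ le_mod y x >].

Lemma eq_mod_refl : reflexive eq_mod.
Proof. by move=> x; apply/asboolP; split; exact: le_mod_refl. Qed.

Lemma eq_mod_sym : symmetric eq_mod.
Proof. by move=> x y; apply/asboolP/asboolP => -[]. Qed.

Lemma eq_mod_trans : transitive eq_mod.
Proof.
move=> y x z /asboolP[xy yx] /asboolP[yz zy]; apply/asboolP.
by split; apply: (@le_mod_trans y).
Qed.

Canonical eq_mod_equiv := EquivRel eq_mod eq_mod_refl eq_mod_sym eq_mod_trans.
Local Notation Q := {eq_quot eq_mod_equiv}%qT.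
Local Notation cl := (\pi_Q%qT : M -> Q).

Lemma clE x y : cl x = cl y <-> le_mod x y /\ le_mod y x.
Proof.
split => [/(@eqmodP _ eq_mod_equiv)/asboolP //|xy].
by apply/(@eqmodP _ eq_mod_equiv)/asboolP.
Qed.

Let clP (X : Q) : exists x, X = cl x.
Proof. by exists (repr X); rewrite reprK. Qed.

Let clP2 (X Y : Q) : exists b x y,
  [/\ idem b, ~ A b, x <= b, y <= b & X = cl x /\ Y = cl y].
Proof.
have [x ->] := clP X; have [y ->] := clP Y.
by have [b [idb Ab xb yb]] := idem_outside2 x y; exists b, x, y.
Qed.

Lemma lambda_mod_le b c x y : idem b -> ~ A b -> idem c -> ~ A c ->
  x <= b -> y <= c -> le_mod y x -> le_mod (lambda b x) (lambda c y).
Proof.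
move=> idb Ab idc Ac xb yc yx; apply/lambda_mod => //.
apply: (le_mod_trans (le_mod_idem _ idc Ac)).
rewrite -[X in le_mod X _](lambda_oplus idc yc) oplusC.
by apply: le_modD => //; exact: le_mod_refl.
Qed.

(** The identities of an MV-algebra are inherited from the intervals [[0, b]]
    with [b] an idempotent outside [A], since any finitely many classes have
    representatives in one such interval. *)
Lemma maximal_quotient_MV : exists (op : Q -> Q -> Q) (neg : Q -> Q) (one : Q),
  [/\ MV_algebra_on [set: Q] op neg (cl \bot) one,
      forall x y, op (cl x) (cl y) = cl (x ⊕ y),
      forall b x, idem b -> ~ A b -> x <= b -> neg (cl x) = cl (lambda b x)
    & forall b, idem b -> ~ A b -> one = cl b].
Proof.
have negP (X : Q) : exists Y, forall b x, idem b -> ~ A b -> x <= b ->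
    X = cl x -> Y = cl (lambda b x).
  have [x XE] := clP X; have [b [idb Ab xb _]] := idem_outside2 x x.
  exists (cl (lambda b x)) => c y idc Ac yc; rewrite XE => /clE[xy yx].
  by apply/clE; split; apply: lambda_mod_le.
have [neg negE0] := choice negP.
have negE b x : idem b -> ~ A b -> x <= b -> neg (cl x) = cl (lambda b x).
  by move=> idb Ab xb; exact: negE0 idb Ab xb erefl.
pose op (X Y : Q) := cl (repr X ⊕ repr Y).
have opE x y : op (cl x) (cl y) = cl (x ⊕ y).
  have /clE[x1 x2] : cl (repr (cl x)) = cl x by rewrite reprK.
  have /clE[y1 y2] : cl (repr (cl y)) = cl y by rewrite reprK.
  by apply/clE; split; apply: le_modD.
have [a ida Aa] := idem_outside.
have aE b : idem b -> ~ A b -> cl a = cl b.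
  by move=> idb Ab; apply/clE; split; exact: le_mod_idem.
exists op, neg, (cl a); split => //; split => //.
- by move=> X Y Z _ _ _; have [[[x ->] [y ->]] [z ->]] := (clP X, clP Y, clP Z);
    rewrite !opE oplusA.
- by move=> X Y _ _; have [[x ->] [y ->]] := (clP X, clP Y); rewrite !opE oplusC.
- by move=> X _; have [x ->] := clP X; rewrite opE oplusx0.
- move=> X _; have [b [x [_ [idb Ab xb _ [-> _]]]]] := clP2 X X.
  by rewrite (negE b) // (negE b) ?lambda_le // lambdaK.
- by rewrite (negE a) ?le0x // lambda0.
- move=> X _; have [b [x [_ [idb Ab xb _ [-> _]]]]] := clP2 X X.
  rewrite (aE b) // opE; congr cl; apply/le_anti; rewrite idem_leD //=.
  exact: leDr.
- move=> X Y _ _; have [b [x [y [idb Ab xb yb [-> ->]]]]] := clP2 X Y.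
  have lx := lambda_le idb xb; have ly := lambda_le idb yb.
  rewrite !(negE b, opE) ?lambda_le ?idem_leD //.
  by rewrite lambda_luk.
Qed.

Theorem maximal_ideal_state (R : realType) :
  exists s : M -> unit_interval R, state_morphism s /\ Ker s = A.
Proof.
have [op [neg [one [mv opE negE oneE]]]] := maximal_quotient_MV.
have addE x y : le_mod x y -> op (neg (cl x)) (cl y) = one.
  move=> xy; have [b [idb Ab xb yb]] := idem_outside2 x y.
  rewrite (negE b) // opE (oneE b) //; apply/clE; split; first exact: le_mod_idem.
  rewrite -[X in le_mod X _](lambda_oplus idb xb).
  by apply: le_modD => //; exact: le_mod_refl.
have total X Y : op (neg X) Y = one \/ op (neg Y) X = one.
  have [[x ->] [y ->]] := (clP X, clP Y).
  by have [xy|yx] := le_mod_total x y; [left|right]; exact: addE.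
have [a ida Aa] := idem_outside.
have nontrivial : cl \bot <> one.
  by rewrite (oneE a) // => /clE[_ /le_mod0].
have arch X : X <> cl \bot -> exists n, iter n (op X) (cl \bot) = one.
  have [x ->] := clP X => x0.
  have Ax : ~ A x.
    move=> /le_mod0 Ax; apply: x0; apply/clE; split=> //.
    by apply: le_mod_le; exact: le0x.
  have [n xn] := le_mod_multiple a Ax; exists n.
  have -> : iter n (op (cl x)) (cl \bot) = cl (multiple n x).
    by elim: n {xn} => [//|n IH]; rewrite /= IH opE.
  by rewrite (oneE a) //; apply/clE; split => //; exact: le_mod_idem.
have [h [h01 hD hN h1 h0]] := mv_chain_embedding mv total nontrivial arch R.
pose s x : unit_interval R := Itv01 (andP (h01 (cl x))).1 (andP (h01 (cl x))).2.
have sE x : ui_val (s x) = h (cl x) by [].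
have hbot : h (cl \bot) = 0%R.
  by rewrite -[LHS](subKr 1%R) -hN (MV_neg0 mv) h1 subrr.
have sle x y : le_mod x y -> s x <= s y.
  move=> /addE xy; rewrite ui_leE !sE.
  have := hD (neg (cl x)) (cl y); rewrite xy h1 hN => /esym/eqP.
  by rewrite eq_minr -addrA lerDl addrC subr_ge0.
have seq x y : le_mod x y -> le_mod y x -> s x = s y.
  by move=> xy yx; apply/le_anti; rewrite !sle.
have s0 x : A x -> s x = ui0 R.
  move=> /le_mod0 Ax; have -> : s x = s \bot.
    by apply: seq => //; apply: le_mod_le; exact: le0x.
  by apply: ui_val_inj; rewrite sE hbot.
have s1 b : idem b -> ~ A b -> s b = ui1 R.
  by move=> idb Ab; apply: ui_val_inj; rewrite sE -(oneE b) // h1.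
have sK : Ker s = A.
  apply/seteqP; split => [x|x /s0 //] /(congr1 (@ui_val R)); rewrite sE => /h0.
  by move=> /clE[+ _] => /le_mod0.
exists s; split => //; split; last by exists a; exact: s1.
split.
- move=> x y; wlog xy : x y / le_mod x y => [hwlog|].
    have [|yx] := le_mod_total x y; first exact: hwlog.
    by rewrite joinC hwlog // joinC.
  rewrite (join_r (sle _ _ xy)); apply: seq.
    by apply: le_modU => //; exact: le_mod_refl.
  by apply: le_mod_le; exact: leUr.
- move=> x y; wlog xy : x y / le_mod x y => [hwlog|].
    have [|yx] := le_mod_total x y; first exact: hwlog.
    by rewrite meetC hwlog // meetC.
  rewrite (meet_l (sle _ _ xy)); apply: seq.
    by apply: le_mod_le; exact: leIl.
  by apply: le_modI => //; exact: le_mod_refl.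
- by move=> x y; apply: ui_val_inj; rewrite ui_oplusE !sE -opE hD.
- by apply: s0; exact: ideal0.
- move=> b x idb xb; have [Ab|Ab] := pselect (A b).
    have As y : y <= b -> s y = ui0 R by move=> yb; apply: s0; exact: ideal_le yb Ab.
    by rewrite !As ?lambda_le // /lambda ui_lambda0.
  rewrite (s1 b) // /lambda ui_lambda1; apply: ui_val_inj.
  by rewrite ui_negE !sE -/(lambda b x) -(negE b) // hN.
Qed.

End maximal_quotient.

(** * State-morphisms are locally determined by where they vanish *)

Section states.
Context (R : realType) d (M : emvType d).
Implicit Types (x y z u v w a b c m : M) (s t : M -> unit_interval R).
Local Notation val s x := (ui_val (s x)).

Lemma stateD s x y : state_morphism s ->
  val s (x ⊕ y) = Num.min (val s x + val s y)%R 1%R.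
Proof. by case=> hs _; rewrite (emv_homD hs) -ui_oplusE. Qed.

Lemma state_le s x y : state_morphism s -> x <= y -> (val s x <= val s y)%R.
Proof.
by case=> hs _ /join_r xy; rewrite -ui_leE -xy (emv_homU hs) leUl.
Qed.

Lemma state0 s : state_morphism s -> s \bot = ui0 R.
Proof. by case=> hs _; rewrite (emv_hom0 hs). Qed.

Lemma state_idem s b : state_morphism s -> idem b ->
  s b <> ui0 R -> s b = ui1 R.
Proof.
case=> hs _ idb; case: (@ui_idem R (s b)) => //.
by rewrite -[RHS]/(s b) -{3}idb (emv_homD hs).
Qed.

Lemma state_lambda s b x : state_morphism s -> idem b -> x <= b ->
  s b <> ui0 R -> val s (lambda b x) = (1 - val s x)%R.
Proof.
move=> hs idb xb sb; case: (hs) => hom _.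
by rewrite (emv_hom_lambda hom) // (state_idem hs) // /lambda ui_lambda1 ui_negE.
Qed.

Lemma ui_eq0 (p : unit_interval R) : p = ui0 R <-> ui_val p = 0%R.
Proof. by split => [->//|p0]; apply: ui_val_inj. Qed.

Lemma ui01 : ui1 R <> ui0 R.
Proof. by move=> /(congr1 (@ui_val R))/eqP; apply/negP; exact: oner_neq0. Qed.

Lemma state_idem_above s x : state_morphism s ->
  exists b, [/\ idem b, x <= b & s b <> ui0 R].
Proof.
move=> hs; case: (hs) => _ [u su]; have [b [idb xb ub]] := idem_above2 x u.
exists b; split => // /ui_eq0 sb; have := state_le hs ub; rewrite su sb.
by rewrite leNgt => /negP; apply; exact: ltr01.
Qed.

Lemma Ker_ideal s : state_morphism s -> ideal (Ker s).
Proof.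
move=> hs; split.
- by exists \bot; exact: state0.
- move=> x y xy /ui_eq0 sy; apply/ui_eq0/le_anti.
  by rewrite ui_ge0 andbT -sy state_le.
- move=> x y /ui_eq0 sx /ui_eq0 sy; apply/ui_eq0.
  by rewrite stateD // sx sy add0r; apply/min_idPl; exact: ler01.
Qed.

Lemma state_multiple s x : state_morphism s -> s x <> ui0 R ->
  exists n, val s (multiple n x) = 1%R.
Proof.
move=> hs sx; have xp : (0 < val s x)%R.
  by rewrite lt_def ui_ge0 andbT; apply/eqP => /ui_eq0.
have [n nx] : exists n, (1 <= n%:R * val s x)%R.
  exists (Num.bound (val s x)^-1%R); rewrite -ler_pdivrMr // div1r ltW //.
  by apply: archi_boundP; rewrite invr_ge0 ui_ge0.
exists n; have -> : val s (multiple n x) = Num.min (n%:R * val s x)%R 1%R.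
  elim: n {nx} => [|n IH].
    by rewrite state0 // mul0r; apply/esym/min_idPl; exact: ler01.
  rewrite /= stateD // IH mulrS mulrDl mul1r /Num.min.
  have := ui_ge0 (s x); move: (ui_val _) (_ * _)%R => p q p0.
  by case: (ltP q 1%R) => ?; do ![case: ltP => ?]; lra.
exact/min_idPr.
Qed.

(** If [s x] is nonzero, some multiple of [x] has value 1; any [y] lies below that
    multiple plus the difference of the two, and this difference is in the
    kernel. *)
Lemma Ker_maximal s : state_morphism s -> maximal_ideal (Ker s).
Proof.
move=> hs; split; first exact: Ker_ideal.
  case: (hs) => _ [x sx] K; have : Ker s x by rewrite K.
  by rewrite /Ker /= sx; exact: ui01.
move=> J hJ JT [KJ]; apply; move=> x Jx; apply: contrapT => sx; apply: JT.
have [n nx] := state_multiple hs sx.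
have Jn : J (multiple n x).
  by elim: n {nx} => [|n IH]; [exact: ideal0|exact: idealD].
apply/seteqP; split => // y _.
have [b [idb + sb]] := state_idem_above (y `|` multiple n x) hs.
rewrite leUx => /andP[yb nb]; have ly := lambda_le idb yb.
have lyn : lambda b y ⊕ multiple n x <= b by exact: idem_leD.
apply: (@ideal_le _ _ _ _ (multiple n x ⊕ lambda b (lambda b y ⊕ multiple n x)) hJ).
  by apply/(le_residual idb yb nb (lambda_le idb lyn)).
apply: idealD => //; apply: KJ; apply/ui_eq0.
rewrite state_lambda // stateD // nx.
suff /min_idPr -> : (1 <= val s (lambda b y) + 1)%R by rewrite subrr.
by rewrite lerDr ui_ge0.
Qed.

(** By induction on [n], halving the error: if [s x < 1/2], the estimate for
    [x ⊕ x] is used, together with the condition that [x ⊕ x] stays below 1,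
    which is the non-vanishing of its complement; if [s x > 1/2], [x] is
    replaced by its complement. If [s x] is exactly 1/2, no open condition
    selects a side, but the doubles of [x] and of its complement have value 1,
    and the lower estimates for them bound [t x] from both sides. *)
Lemma state_approx s x n : state_morphism s ->
  exists2 y, s y <> ui0 R & forall t, state_morphism t -> t y <> ui0 R ->
    (`|val t x - val s x| <= 2^-n)%R.
Proof.
move=> hs; elim: n x => [|n IH] x.
  have [y [_ _ sy]] := state_idem_above x hs; exists y => // t ht _.
  rewrite expr0 invr1 ler_norml.
  have := ui_ge0 (t x); have := ui_ge0 (s x).
  have := ui_le1 (t x); have := ui_le1 (s x); lra.
(* by primeness, finitely many such conditions combine into one *)
have meetN t y z : state_morphism t ->
    t (y `&` z) <> ui0 R <-> t y <> ui0 R /\ t z <> ui0 R.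
  move=> ht; split => [tyz|[ty tz]].
    have hK := Ker_ideal ht.
    by split; apply: contra_not tyz => t0; apply: (ideal_le hK _ t0);
      [exact: leIl|exact: leIr].
  by move=> /(maximal_ideal_prime (Ker_maximal ht))[].
have small u : (val s u < 2^-1)%R ->
  exists2 y, s y <> ui0 R & forall t, state_morphism t -> t y <> ui0 R ->
    (`|val t u - val s u| <= 2^-n.+1)%R.
  move=> su; have [y sy yP] := IH (u ⊕ u).
  have [b [idb uub sb]] := state_idem_above (u ⊕ u) hs.
  exists (y `&` (b `&` lambda b (u ⊕ u))).
    apply/meetN => //; split=> //; apply/meetN => //; split => //.
    move/ui_eq0; rewrite state_lambda // stateD // /Num.min.
    by case: ltP => ?; lra.
  move=> t ht /meetN[] // ty /meetN[] // tb tl.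
  have := yP t ht ty; rewrite !stateD // [Num.min (val s u + _)%R _]min_l; last by lra.
  have tu : (val t u + val t u < 1)%R.
    rewrite ltNge; apply/negP => tu; apply: tl; apply/ui_eq0.
    by rewrite state_lambda // stateD // min_r // subrr.
  rewrite min_l; last by rewrite ltW.
  rewrite exprS invfM; move: (2 ^- n)%R => e.
  by rewrite !ler_norml => /andP[? ?]; apply/andP; split; lra.
have [b [idb xb sb]] := state_idem_above x hs.
have [sx|sx|sx] := ltgtP (val s x) 2^-1%R; first exact: small.
  have [|y sy yP] := small (lambda b x); first by rewrite state_lambda //; lra.
  exists (y `&` b); first by apply/meetN.
  move=> t ht /meetN[] // ty tb; have := yP t ht ty.
  by rewrite !state_lambda // -normrN; congr (`|_| <= _)%R; lra.
have [y sy yP] := IH (x ⊕ x).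
have [z sz zP] := IH (lambda b x ⊕ lambda b x).
exists (y `&` (z `&` b)); first by apply/meetN => //; split=> //; apply/meetN.
move=> t ht /meetN[] // ty /meetN[] // tz tb.
have := yP t ht ty; have := zP t ht tz; rewrite !stateD // !state_lambda // sx.
rewrite [Num.min (2^-1 + _)%R _]min_r; last by lra.
rewrite [Num.min (1 - 2^-1 + _)%R _]min_r; last by lra.
rewrite exprS invfM; move: (2 ^- n)%R => e.
have minP (p q : R) : (- p <= Num.min q 1 - 1 -> 1 - p <= q)%R.
  by case: (ltP q 1%R) => ? ?; lra.
rewrite !ler_norml => /andP[/minP ? _] /andP[/minP ? _].
by apply/andP; split; lra.
Qed.

Lemma state_eq s t : state_morphism s -> state_morphism t -> Ker s = Ker t ->
  s = t.
Proof.
move=> hs ht st; apply/funext => x; apply: ui_val_inj; apply/esym/eqP.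
rewrite -subr_eq0; apply/eqP; apply: (@bounded_mul_eq0 _ _ 1%R) => n.
have [y sy yP] := state_approx x n hs.
have ty : t y <> ui0 R by move=> ty; apply: sy; have : Ker t y by []; rewrite -st.
apply: le_trans (_ : (2 ^+ n * 2 ^- n <= 1)%R); last first.
  by rewrite divff // expf_neq0 // pnatr_eq0.
apply: ler_pM; rewrite ?ler0n ?normr_ge0 ?yP //.
by rewrite -natrX ler_nat ltnW // ltn_expl.
Qed.

End states.

(** * The homeomorphism *)

Section spaces.
Context (R : realType) d (M : emvType d).

Lemma SM_state (s : SM R M) : state_morphism (SM_fun s).
Proof. exact: set_valP s. Qed.

Lemma SM_eval_continuous (x : M) :
  continuous (fun s : SM R M => ui_val (SM_fun s x)).
Proof.
move=> s; apply: (@continuous_comp _ _ _ (fun s : SM R M => SM_fun s x) (@ui_val R)).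
  apply: (@continuous_comp _ _ _ (val : SM R M -> {ptws M -> unit_interval R}) (proj x)).
    exact: initial_continuous.
  exact: proj_continuous.
exact: initial_continuous.
Qed.

Lemma continuous_to_SM (X : topologicalType) (f : X -> SM R M) :
  (forall x, continuous (fun p => ui_val (SM_fun (f p) x) : R)) -> continuous f.
Proof.
move=> fc; apply: continuous_comp_initial => p.
apply/cvg_sup => x U [V] [[W] oW <-] Wfp WU.
apply: (filterS WU); rewrite nbhs_simpl /=.
have gc : continuous (fun p => SM_fun (f p) x).
  by apply: continuous_comp_initial; exact: fc.
by apply: gc; exact: open_nbhs_nbhs.
Qed.

Lemma MaxI_open (B : set (MaxI M)) : open B -> exists2 I, ideal I & hk I = B.
Proof. by case=> I hI <-; exists I. Qed.

Lemma hk_open_set (I : set M) : ideal I -> open (hk I).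
Proof. by move=> hI; exists I. Qed.

Lemma val_MaxI_inj : injective (@MaxI_set d M).
Proof. exact: val_inj. Qed.

Lemma maximal_ideal_MaxI (A : set M) : maximal_ideal A ->
  exists B : MaxI M, MaxI_set B = A.
Proof. by move=> hA; exists (SigSub (mem_set hA)). Qed.

Lemma state_SM (s : M -> unit_interval R) : state_morphism s ->
  exists t : SM R M, SM_fun t = s.
Proof. by move=> hs; exists (SigSub (mem_set hs)). Qed.

(** Omitting [x] means not including the ideal generated by [x]. *)
Lemma outside_nbhs (x : M) (A : MaxI M) : ~ MaxI_set A x ->
  nbhs A [set B : MaxI M | ~ MaxI_set B x].
Proof.
move=> Ax; pose I := ideal_gen [set x].
have hI : ideal I := ideal_gen_ideal _.
have IE (B : MaxI M) : I `<=` MaxI_set B <-> MaxI_set B x.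
  have [hB _ _] := MaxIP B; rewrite /I sub_ideal_gen //.
  by split => [|Bx y ->//]; apply.
rewrite nbhsE; exists (hk I).
  by split; [exact: hk_open_set|move=> /IE].
by move=> B; apply: contra_not => /IE.
Qed.

Theorem Ker_homeomorphism : exists theta : SM R M -> MaxI M,
  (forall s, MaxI_set (theta s) = Ker (SM_fun s)) /\ homeomorphism theta.
Proof.
have [theta thetaE] :=
  choice (fun s : SM R M => maximal_ideal_MaxI (Ker_maximal (SM_state s))).
have stateP (A : MaxI M) : exists s : SM R M, Ker (SM_fun s) = MaxI_set A.
  have [s [hs sA]] := maximal_ideal_state (MaxIP A) R.
  by have [t tE] := state_SM hs; exists t; rewrite tE.
have [g gE] := choice stateP.
exists theta; split => //; split.
  apply/continuousP => _ /MaxI_open[I hI <-].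
  have -> : theta @^-1` hk I =
      \bigcup_(x in I) ((fun s => ui_val (SM_fun s x)) @^-1` [set p : R | p != 0%R]).
    apply/seteqP; split => s /=; rewrite /hk /= thetaE.
      move=> /existsNP[x /not_implyP[Ix sx]]; exists x => //=.
      by apply/eqP => /ui_eq0.
    by move=> [x Ix /= /eqP sx] IK; apply: sx; apply/ui_eq0; exact: IK.
  apply: bigcup_open => x _; apply: open_comp; last exact: open_neq.
  by move=> s _; exact: SM_eval_continuous.
exists g; split.
- apply: continuous_to_SM => x A; apply/(@cvgrPdist_le _ _ _ _ (nbhs_filter A)) => e e0.
  have [n ne] : exists n, (2 ^- n <= e)%R.
    exists (Num.bound e^-1%R); rewrite -[e in (_ <= e)%R]invrK lef_pV2 ?posrE.
    - apply: le_trans (ltW (archi_boundP _)) _; first by rewrite invr_ge0 ltW.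
      by rewrite -natrX ler_nat ltnW // ltn_expl.
    - by rewrite exprn_gt0 // ltr0n.
    - by rewrite invr_gt0.
  have [y sy yP] := state_approx x n (SM_state (g A)).
  have Ay : ~ MaxI_set A y by rewrite -gE.
  apply: (@filterS _ (nbhs A) (nbhs_filter A) _ _ _ (outside_nbhs Ay)) => B /=.
  rewrite -gE => By.
  by rewrite distrC; apply: le_trans ne; apply: yP => //; exact: SM_state.
- move=> s; apply: val_inj; apply: state_eq; [exact: SM_state|exact: SM_state|].
  by rewrite -[LHS]/(Ker (SM_fun (g (theta s)))) gE thetaE.
- by move=> A; apply: val_MaxI_inj; rewrite thetaE gE.
Qed.

End spaces.

(** * Compactness and top elements *)

Section compactness.
Context d (M : emvType d).

(** The elements that belong to almost every ideal along a filter form an ideal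
    that misses the top; a maximal ideal above it is a cluster point. *)
Lemma top_compact : has_top M -> compact [set: MaxI M].
Proof.
move=> [t tP] F PF _.
have idt : idem t by apply/le_anti; rewrite tP leDl.
pose I := [set x | F [set A : MaxI M | MaxI_set A x]].
have hI : ideal I.
  split.
  - exists \bot; rewrite /I /=; apply: filterS filterT => A _.
    by have [hA _ _] := MaxIP A; exact: ideal0.
  - move=> x y xy; rewrite /I /=; apply: filterS => A.
    by have [hA _ _] := MaxIP A; exact: ideal_le.
  - move=> x y Ix Iy; rewrite /I /=; apply: filterS2 Ix Iy => A.
    by have [hA _ _] := MaxIP A; exact: idealD.
have It : ~ I t.
  move=> /filter_ex[A At]; have [hA AT _] := MaxIP A; apply: AT.
  by apply/seteqP; split => // x _; exact: ideal_le (tP x) At.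
have [A0 [hA IA _]] := maximal_ideal_separation hI idt It.
have [A AE] := maximal_ideal_MaxI hA.
exists A; split => // G U FG; rewrite nbhsE => -[V [/MaxI_open[J hJ <-] nJA] VU].
move: nJA => /existsNP[y /not_implyP[Jy Ay]].
have Iy : ~ I y by move=> /IA; rewrite -AE.
have /existsNP[B /not_implyP[GB By]] : ~ (G `<=` [set B : MaxI M | MaxI_set B y]).
  by move=> GB; apply: Iy; exact: filterS GB FG.
exists B; split => //; apply: VU => JB; apply: By; exact: JB.
Qed.

(** Without a top, every idempotent lies in some maximal ideal, and the sets of
    maximal ideals through an idempotent are directed; a cluster point would
    contain all idempotents, hence be improper. *)
Lemma compact_top : compact [set: MaxI M] -> has_top M.
Proof.
move=> cM; apply: contrapT => ntop.
pose V (a : M) := [set A : MaxI M | MaxI_set A a].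
have V0 a : idem a -> V a !=set0.
  move=> ida; have /existsNP[x /negP xa] : ~ forall x, x <= a.
    by move=> aP; apply: ntop; exists a.
  have [c [idc xc _]] := idem_above2 x x.
  have hI : ideal [set y | y <= a].
    split; first by exists \bot; exact: le0x.
      by move=> u v uv va; exact: le_trans va.
    by move=> u v; exact: idem_leD.
  have ca : ~ c <= a by move=> ca; move/negP: xa; apply; exact: le_trans ca.
  have [A0 [hA IA _]] := maximal_ideal_separation hI idc ca.
  by have [A AE] := maximal_ideal_MaxI hA; exists A; rewrite /V /= AE; exact: IA (lexx a).
have FV : ProperFilter (filter_from [set a : M | idem a] V).
  apply: filter_from_proper => [|a]; last exact: V0.
  apply: filter_from_filter; first by exists \bot; exact: oplus0x.
  move=> a b ida idb; have [c [idc ac bc]] := idem_above2 a b; exists c => // A Ac.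
  by have [hA _ _] := MaxIP A; split; [exact: ideal_le ac Ac|exact: ideal_le bc Ac].
have [|A [_ clA]] := cM _ FV; first by exists \bot => //; exact: oplus0x.
have [a ida Aa] := idem_outside (MaxIP A).
have Va : filter_from [set a : M | idem a] V (V a) by exists a.
by have [B [Ba]] := clA _ _ Va (outside_nbhs Aa); apply.
Qed.

End compactness.

Theorem theorem4p8 (R : realType) (d : Order.disp_t) (M : emvType d) :
  (exists theta : SM R M -> MaxI M,
     (forall s : SM R M, MaxI_set (theta s) = Ker (SM_fun s)) /\
     homeomorphism theta) /\
  [<-> has_top M;
       compact [set: SM R M];
       compact [set: MaxI M] ].
Proof.
have [theta [thetaE homeo]] := Ker_homeomorphism R M.
split; first by exists theta.
have [thetac [g [gc thetaK gK]]] := homeo.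
have transport (X Y : topologicalType) (f : X -> Y) (h : Y -> X) :
    continuous f -> cancel h f -> compact [set: X] -> compact [set: Y].
  move=> fc hK cX; have -> : [set: Y] = f @` [set: X].
    by apply/seteqP; split => // y _; exists (h y).
  by apply: continuous_compact cX; exact: continuous_subspaceT.
tfae.
- by move=> /top_compact; exact: transport gc thetaK.
- exact: transport thetac gK.
- exact: compact_top.
Qed.
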